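(* Suppose that $W(x)$ is an $N\times N$ weight matrix with $\mathbb CI\subsetneq\mathcal Z(W)$, where $\mathcal Z(W)$ is the center of $\mathcal D(W)$. Then the module rank of $\mathcal D(W)$ is at most $N$.
   Context: Differential operators act on the right: $M_N(\Omega[x])$ is the algebra of matrix differential operators $\mathfrak D=\sum_j\partial_x^jA_j(x)$ with $A_j\in M_N(\mathbb C[x])$, acting on matrix functions by $F\cdot\mathfrak D=\sum_jF^{(j)}A_j$, with product determined by $F\cdot(\mathfrak D\mathfrak E)=(F\cdot\mathfrak D)\cdot\mathfrak E$. A weight matrix $W$ supported on an interval $(x_0,x_1)$ (possibly infinite) is a Hermitian matrix-valued function $W:\mathbb R\to M_N(\mathbb C)$, zero outside $(x_0,x_1)$, entrywise smooth and positive definite on $(x_0,x_1)$, with finite moments $\int x^mW(x)dx$ for all $m\ge0$. It defines $\langle P,Q\rangle_W=\int P(x)W(x)Q(x)^*dx$ for $P,Q\in M_N(\mathbb C[x])$. The sequence of monic orthogonal polynomials $P(x,n)$, $n\ge0$, of $W$ is the unique sequence in $M_N(\mathbb C[x])$ with $P(x,n)$ of degree $n$ and leading coefficient $I$, and $\langle P(x,n),P(x,m)\rangle_W=0$ for $m\ne n$. $\mathcal D(W)$ is the algebra of all $\mathfrak D\in M_N(\Omega[x])$ for which there are matrices $\Lambda(n)\in M_N(\mathbb C)$ with $P(x,n)\cdot\mathfrak D=\Lambda(n)P(x,n)$ for all $n\geq0$. Module rank: let $\mathcal F(W)$ be the total ring of fractions of $\mathcal Z(W)$, $\mathcal P_1(W),\dots,\mathcal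 P_r(W)$ the minimal primes of $\mathcal Z(W)$ and $\mathcal F_i(W)$ the localization of $\mathcal Z(W)$ at $\mathcal P_i(W)$ (a field). There is an algebra isomorphism $\mathcal D(W)\otimes_{\mathcal Z(W)}\mathcal F(W)\cong\bigoplus_{i=1}^rM_{n_i}(\mathcal F_i(W))$ for uniquely determined positive integers $n_i$. The module rank of $\mathcal D(W)$ (over $\mathcal Z(W)$) is $n_1+\dots+n_r$. *)

(* Defs.v *)
From HB Require Import structures.
From mathcomp Require Import all_boot all_order all_algebra.
From mathcomp Require Import complex.
From mathcomp Require Import all_classical all_reals all_analysis.

Set Implicit Arguments.
Unset Strict Implicit.
Unset Printing Implicit Defensive.

Import Order.TTheory GRing.Theory Num.Theory.
Import numFieldNormedType.Exports.

Local Open Scope classical_set_scope.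
Local Open Scope ring_scope.

(** * Differential operators acting on the right *)

(* [D : diffop C] is the operator [\sum_j \partial^j D`_j]: powers of the
   derivation on the left, polynomial coefficients on the right.  The additive
   group is that of {poly {poly C}}, the product is not. *)
Definition diffop (C : numDomainType) : Type := {poly {poly C}}.

HB.instance Definition _ (C : numDomainType) :=
  GRing.Zmodule.copy (diffop C) {poly {poly C}}.

Section DiffOp.
Variable C : numDomainType.
Local Notation coefs D := (D : {poly {poly C}}).
Implicit Types (f a : {poly C}) (D E : diffop C).

Definition diffop_act f D : {poly C} :=
  \sum_(j < size (coefs D)) f^`(j) * (coefs D)`_j.

(* D \partial, from (f^`(j) * a)^`() = f^`(j.+1) * a + f^`(j) * a^`(). *)
Definition diffop_mul_dx D : diffop C :=
  (coefs D) * 'X + map_poly (@deriv C) D.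

(* D (\sum_j \partial^j E_j) = \sum_j (D \partial^j) E_j *)
Definition diffop_mul D E : diffop C :=
  \sum_(j < size (coefs E))
    coefs (iter j diffop_mul_dx D) * ((coefs E)`_j)%:P.

Definition diffop_const a : diffop C := a%:P.

Lemma diffop_act_wide n f D : (size (coefs D) <= n)%N ->
  diffop_act f D = \sum_(j < n) f^`(j) * (coefs D)`_j.
Proof.
move=> sD; rewrite /diffop_act.
rewrite -(big_mkord xpredT (fun j => f^`(j) * (coefs D)`_j)).
rewrite -(big_mkord xpredT (fun j => f^`(j) * (coefs D)`_j)).
rewrite [RHS](big_cat_nat (leq0n _) sD) /= [X in _ + X]big1_seq ?addr0 //.
move=> j; rewrite mem_index_iota => /andP[_ /andP[sj _]].
by rewrite nth_default // mulr0.
Qed.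

Lemma diffop_actD f D E :
  diffop_act f (D + E) = diffop_act f D + diffop_act f E.
Proof.
pose n := maxn (size (coefs D)) (size (coefs E)).
have h1 := @diffop_act_wide n f D (leq_maxl _ _).
have h2 := @diffop_act_wide n f E (leq_maxr _ _).
have h3 := @diffop_act_wide n f (D + E) (size_polyD _ _).
rewrite h1 h2 h3 -big_split /=; apply: eq_bigr => i _.
by rewrite coefD mulrDr.
Qed.

Lemma diffop_act0 f : diffop_act f 0 = 0.
Proof. by rewrite /diffop_act size_poly0 big_ord0. Qed.

Lemma diffop_actDl f g D :
  diffop_act (f + g) D = diffop_act f D + diffop_act g D.
Proof.
by rewrite /diffop_act -big_split; apply: eq_bigr => i _; rewrite derivnD mulrDl.
Qed.

Lemma diffop_act0l D : diffop_act 0 D = 0.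
Proof. by rewrite /diffop_act big1 // => i _; rewrite linear0 mul0r. Qed.

Lemma diffop_act_sum f (I : Type) (r : seq I) (F : I -> diffop C) :
  diffop_act f (\sum_(i <- r) F i) = \sum_(i <- r) diffop_act f (F i).
Proof.
elim: r => [|i r IH]; first by rewrite !big_nil diffop_act0.
by rewrite !big_cons diffop_actD IH.
Qed.

Lemma diffop_act_suml (I : Type) (r : seq I) (F : I -> {poly C}) D :
  diffop_act (\sum_(i <- r) F i) D = \sum_(i <- r) diffop_act (F i) D.
Proof.
elim: r => [|i r IH]; first by rewrite !big_nil diffop_act0l.
by rewrite !big_cons diffop_actDl IH.
Qed.

Lemma diffop_actMc f D a :
  diffop_act f ((coefs D) * a%:P) = diffop_act f D * a.
Proof.
have sz : (size ((coefs D) * a%:P)%R <= size (coefs D))%N.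
  apply/leq_sizeP => j sj.
  by rewrite coefMC nth_default // mul0r.
rewrite (diffop_act_wide f sz) /diffop_act mulr_suml.
by apply: eq_bigr => i _; rewrite coefMC mulrA.
Qed.

Lemma diffop_act_mul_dx f D :
  diffop_act f (diffop_mul_dx D) = (diffop_act f D)^`().
Proof.
rewrite /diffop_mul_dx diffop_actD /diffop_act.
pose n := size (coefs D).
have h1 : (size ((coefs D) * 'X)%R <= n.+1)%N.
  apply/leq_sizeP => -[|j] //; rewrite coefMX /= => sj.
  by rewrite nth_default.
have h2 : (size (map_poly (@deriv C) D) <= n)%N by exact: size_poly.
have := diffop_act_wide f h1; rewrite /diffop_act => ->.
have := diffop_act_wide f h2; rewrite /diffop_act => ->.
rewrite big_ord_recl coefMX /= mulr0 add0r linear_sum -big_split /=.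
apply: eq_bigr => i _; rewrite coefMX /= derivM coef_map_id0 ?linear0 //.
Qed.

Lemma diffop_actM f D E :
  diffop_act f (diffop_mul D E) = diffop_act (diffop_act f D) E.
Proof.
rewrite /diffop_mul diffop_act_sum [RHS]/diffop_act.
apply: eq_bigr => j _; rewrite diffop_actMc; congr (_ * _).
by elim: (val j) => [|k IH] //=; rewrite diffop_act_mul_dx IH.
Qed.

Lemma diffop_act_const f a : diffop_act f (diffop_const a) = f * a.
Proof.
rewrite (@diffop_act_wide 1%N) ?size_polyC_leq1 // big_ord1.
by rewrite /diffop_const coefC.
Qed.

Lemma diffop_act_inj D E :
  (forall f, diffop_act f D = diffop_act f E) -> D = E.
Proof.
move=> DE; apply/eqP; rewrite -subr_eq0; apply/eqP.
pose G : {poly {poly C}} := D - E.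
have G0 f : diffop_act f G = 0.
  apply: (addIr (diffop_act f E)).
  by rewrite -diffop_actD /G subrK add0r DE.
suff Gj j : G`_j = 0 by apply/polyP => j; rewrite [LHS]Gj coef0.
elim/ltn_ind: j => j IH.
have := G0 'X^j; rewrite (@diffop_act_wide (maxn (size G) j.+1)) ?leq_maxl //.
have jlt : (j < maxn (size G) j.+1)%N by rewrite leq_max ltnSn orbT.
rewrite (bigD1 (Ordinal jlt)) //= big1 => [|i /eqP ij]; last first.
  have [lij|] := ltnP i j; first by rewrite IH // mulr0.
  rewrite leq_eqVlt => /orP[/eqP ji|ji]; first by case: ij; apply: val_inj.
  by rewrite derivn_poly0 ?mul0r // size_polyXn.
rewrite addr0 derivnXn subnn expr0 ffactnn => /eqP.
rewrite mulf_eq0 -polyC1 -polyCMn polyC_eq0 pnatr_eq0.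
by rewrite -leqn0 leqNgt fact_gt0 /= => /eqP.
Qed.

Fact diffop_mulA : associative diffop_mul.
Proof. by move=> D E G; apply: diffop_act_inj => f; rewrite !diffop_actM. Qed.

Fact diffop_mul1l : left_id (diffop_const 1) diffop_mul.
Proof.
move=> D; apply: diffop_act_inj => f.
by rewrite diffop_actM diffop_act_const mulr1.
Qed.

Fact diffop_mul1r : right_id (diffop_const 1) diffop_mul.
Proof.
move=> D; apply: diffop_act_inj => f.
by rewrite diffop_actM diffop_act_const mulr1.
Qed.

Fact diffop_mulDl : left_distributive diffop_mul +%R.
Proof.
move=> D E G; apply: diffop_act_inj => f.
by rewrite diffop_actM !diffop_actD diffop_actDl !diffop_actM.
Qed.

Fact diffop_mulDr : right_distributive diffop_mul +%R.
Proof.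
move=> D E G; apply: diffop_act_inj => f.
by rewrite diffop_actM !diffop_actD !diffop_actM.
Qed.

Fact diffop_1neq0 : diffop_const 1 != 0.
Proof. by rewrite polyC_eq0 oner_neq0. Qed.

HB.instance Definition _ := GRing.Zmodule_isNzRing.Build (diffop C)
  diffop_mulA diffop_mul1l diffop_mul1r diffop_mulDl diffop_mulDr diffop_1neq0.

(* With 𝔇 = \sum_j \partial^j A_j and 𝔇_kl = \sum_j \partial^j (A_j)_kl, this is
   F . 𝔇 = \sum_j F^(j) A_j. *)
Definition mxdiffop_act N (F : 'M[{poly C}]_N) (D : 'M[diffop C]_N) :
    'M[{poly C}]_N :=
  \matrix_(i, j) \sum_k diffop_act (F i k) (D k j).

Lemma mxdiffop_actM N (F : 'M[{poly C}]_N) (D E : 'M[diffop C]_N) :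
  mxdiffop_act F (D * E) = mxdiffop_act (mxdiffop_act F D) E.
Proof.
apply/matrixP => i j; rewrite !mxE.
under eq_bigr do rewrite mxE diffop_act_sum.
rewrite exchange_big /=; apply: eq_bigr => l _; rewrite mxE.
rewrite diffop_act_suml; apply: eq_bigr => k _.
exact: diffop_actM.
Qed.

Lemma mxdiffop_actD N (F : 'M[{poly C}]_N) (D E : 'M[diffop C]_N) :
  mxdiffop_act F (D + E) = mxdiffop_act F D + mxdiffop_act F E.
Proof.
apply/matrixP => i j; rewrite !mxE -big_split /=.
by apply: eq_bigr => k _; rewrite mxE diffop_actD.
Qed.

Lemma mxdiffop_act1 N (F : 'M[{poly C}]_N) : mxdiffop_act F 1 = F.
Proof.
apply/matrixP => i j; rewrite !mxE (bigD1 j) //= big1 => [|k kj].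
  by rewrite mxE eqxx addr0 [LHS]diffop_act_const mulr1.
by rewrite mxE (negPf kj) diffop_act0.
Qed.

Lemma mxdiffop_act_mull N (A : 'M[C]_N) (F : 'M[{poly C}]_N)
    (D : 'M[diffop C]_N) :
  mxdiffop_act (map_mx polyC A *m F) D = map_mx polyC A *m mxdiffop_act F D.
Proof.
apply/matrixP => i j; rewrite !mxE.
under [RHS]eq_bigr do rewrite [mxdiffop_act _ _ _ _]mxE mulr_sumr.
rewrite exchange_big /=; apply: eq_bigr => k _; rewrite mxE.
rewrite diffop_act_suml; apply: eq_bigr => l _; rewrite mxE /diffop_act mulr_sumr.
by apply: eq_bigr => m _; rewrite !mul_polyC derivnZ -scalerAl.
Qed.

Definition scalar_mxdiffop N (c : C) : 'M[diffop C]_N := (diffop_const c%:P)%:M.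

End DiffOp.

(** * Weight matrices and their orthogonal polynomials *)

Section Weight.
Variables (R : realType) (N : nat).
Local Notation C := R[i].
Local Notation mu := (@lebesgue_measure R).
Implicit Types W : R -> 'M[C]_N.

(* [0 < z] in R[i] means that z is real and positive. *)
Definition posdef_mx (A : 'M[C]_N) : Prop :=
  forall v : 'rV[C]_N, v != 0 -> 0 < (v *m A *m (map_mx Num.conj v)^T) 0 0.

Definition in_support (x0 x1 : \bar R) (x : R) : Prop :=
  (x0 < x%:E)%E /\ (x%:E < x1)%E.

Definition smooth_on (A : set R) (f : R -> R) : Prop :=
  forall (k : nat) (x : R), A x -> derivable (derive1n k f) x 1.

Record weight_matrix (x0 x1 : \bar R) W : Prop := WeightMatrix {
  weight_supp_nonempty : (x0 < x1)%E;
  weight_hermitian : forall x, W x \is hermsymmx;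
  weight_zero : forall x, ~ in_support x0 x1 x -> W x = 0;
  weight_smooth : forall i j,
    smooth_on (in_support x0 x1) (fun x => complex.Re (W x i j)) /\
    smooth_on (in_support x0 x1) (fun x => complex.Im (W x i j));
  weight_posdef : forall x, in_support x0 x1 x -> posdef_mx (W x);
  weight_moments : forall (m : nat) i j,
    mu.-integrable setT (fun x => (x ^+ m * complex.Re (W x i j))%:E) /\
    mu.-integrable setT (fun x => (x ^+ m * complex.Im (W x i j))%:E) }.

Definition eval_mx (P : 'M[{poly C}]_N) (x : R) : 'M[C]_N :=
  map_mx (horner_eval (x%:C)%C) P.

Definition Cintegral (f : R -> C) : C :=
  Complex (Rintegral mu setT (fun x => complex.Re (f x)))
          (Rintegral mu setT (fun x => complex.Im (f x))).

Definition weight_inner W (P Q : 'M[{poly C}]_N) : 'M[C]_N :=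
  \matrix_(i, j) Cintegral (fun x =>
    (eval_mx P x *m W x *m (map_mx Num.conj (eval_mx Q x))^T) i j).

Definition monic_mxpoly (n : nat) (P : 'M[{poly C}]_N) : Prop :=
  map_mx (coefp n) P = 1%:M /\
  (forall k, (n < k)%N -> map_mx (coefp k) P = 0).

Definition monic_orthogonal W (P : nat -> 'M[{poly C}]_N) : Prop :=
  (forall n, monic_mxpoly n (P n)) /\
  (forall n m, m <> n -> weight_inner W (P n) (P m) = 0).

(* For a weight matrix there is exactly one sequence P to which the universal
   quantifier applies. *)
Definition bispectral_op W (D : 'M[diffop C]_N) : Prop :=
  forall P, monic_orthogonal W P ->
  exists Lambda : nat -> 'M[C]_N,
    forall n, mxdiffop_act (P n) D = map_mx polyC (Lambda n) *m P n.

Definition bispectral_pred W : {pred 'M[diffop C]_N} :=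
  fun D => `[< bispectral_op W D >].

Fact bispectral_subring W : subring_closed (bispectral_pred W).
Proof.
split.
- apply/asboolP => P _; exists (fun=> 1%:M) => n.
  by rewrite mxdiffop_act1 map_mx1 mul1mx.
- move=> D E /asboolP hD /asboolP hE; apply/asboolP => P hP.
  have [L hL] := hD P hP; have [M hM] := hE P hP.
  exists (fun n => L n - M n) => n.
  rewrite map_mxB mulmxBl -hL -hM; apply: (addIr (mxdiffop_act (P n) E)).
  by rewrite -mxdiffop_actD !subrK.
- move=> D E /asboolP hD /asboolP hE; apply/asboolP => P hP.
  have [L hL] := hD P hP; have [M hM] := hE P hP.
  exists (fun n => L n *m M n) => n.
  by rewrite mxdiffop_actM hL mxdiffop_act_mull hM map_mxM mulmxA.
Qed.

Definition bispectral_alg W : Type := {D | D \in bispectral_pred W}.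

HB.instance Definition _ W := SubChoice.on (bispectral_alg W).
HB.instance Definition _ W := GRing.SubChoice_isSubPzRing.Build _ _
  (bispectral_alg W) (bispectral_subring W).

End Weight.

(** * The center of a ring *)

Section Center.
Variable A : pzRingType.

Definition center_pred : {pred A} := fun a => `[< forall b, a * b = b * a >].

Fact center_subring : subring_closed center_pred.
Proof.
split.
- by apply/asboolP => b; rewrite mul1r mulr1.
- move=> a b /asboolP ha /asboolP hb; apply/asboolP => c.
  by rewrite mulrBl mulrBr ha hb.
- move=> a b /asboolP ha /asboolP hb; apply/asboolP => c.
  by rewrite -mulrA hb mulrA ha mulrA.
Qed.

Definition center : Type := {a | a \in center_pred}.

HB.instance Definition _ := SubChoice.on center.
HB.instance Definition _ := GRing.SubChoice_isSubPzRing.Build _ _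
  center center_subring.

Fact center_mulC : commutative (@GRing.mul center).
Proof.
move=> a b; apply: val_inj; rewrite !rmorphM /=.
by have /asboolP -> := valP a.
Qed.

HB.instance Definition _ :=
  GRing.PzRing_hasCommutativeMul.Build center center_mulC.

End Center.

(** * Localizations, minimal primes, tensor products *)

Section CommutativeAlgebra.
Variable Z : comPzRingType.

Definition is_localization (S : set Z) (L : comPzRingType)
    (f : {rmorphism Z -> L}) : Prop :=
  [/\ forall s, S s -> exists u, f s * u = 1,
      forall y, exists a s, S s /\ y * f s = f a
    & forall a b, f a = f b -> exists2 s, S s & s * a = s * b].

Definition nonzerodivisors : set Z := [set s | forall a, s * a = 0 -> a = 0].

Definition is_total_fraction_ring (F : comPzRingType)
    (f : {rmorphism Z -> F}) : Prop :=
  is_localization nonzerodivisors f.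

Record prime_ideal (P : set Z) : Prop := PrimeIdeal {
  prime_ideal0 : P 0;
  prime_idealD : forall a b, P a -> P b -> P (a + b);
  prime_idealM : forall a b, P b -> P (a * b);
  prime_ideal_proper : ~ P 1;
  prime_ideal_prime : forall a b, P (a * b) -> P a \/ P b }.

Definition minimal_prime (P : set Z) : Prop :=
  prime_ideal P /\ forall Q, prime_ideal Q -> Q `<=` P -> Q = P.

(* A is a Z-algebra through the ring morphism i (with central image), and F
   through f. *)
Variables (A : pzRingType) (i : {rmorphism Z -> A}).
Variables (F : comPzRingType) (f : {rmorphism Z -> F}).

Record balanced (V : zmodType) (b : A -> F -> V) : Prop := Balanced {
  balancedDl : forall x y s, b (x + y) s = b x s + b y s;
  balancedDr : forall x s t, b x (s + t) = b x s + b x t;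
  balanced_mid : forall x z s, b (x * i z) s = b x (f z * s) }.

(* [tens a s] is the pure tensor of a and s, and [T] is the tensor product of A
   and F over Z with its usual ring structure. *)
Record is_tensor_product (T : pzRingType) (tens : A -> F -> T) : Prop :=
  IsTensorProduct {
    tensor_balanced : balanced tens;
    tensor_universal : forall (V : zmodType) (b : A -> F -> V), balanced b ->
      exists2 h : {additive T -> V}, (forall x s, h (tens x s) = b x s)
        & forall h' : {additive T -> V},
            (forall x s, h' (tens x s) = b x s) -> h' =1 h;
    tensor1 : tens 1 1 = 1;
    tensorM : forall x y s t, tens x s * tens y t = tens (x * y) (s * t) }.

End CommutativeAlgebra.

(** * Module rank over the center *)

Definition center_incl (A : pzRingType) : {rmorphism center A -> A} :=
  (\val : center A -> A).

(* [is_module_rank A m] says that A \otimes_Z F is isomorphic, as an F-algebra,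
   to the product of the matrix rings 'M[L k]_(n k), where Z is the center of A,
   F its total ring of fractions, the P k its minimal primes (listed without
   repetition) and L k the localization of Z at P k, and that m is the sum of
   the n k > 0. *)
Definition is_module_rank (A : pzRingType) (m : nat) : Prop :=
  let Z := center A in
  exists (F : comPzRingType) (f : {rmorphism Z -> F})
         (T : pzRingType) (tens : A -> F -> T)
         (r : nat) (P : 'I_r -> set Z)
         (L : 'I_r -> comPzRingType) (l : forall k, {rmorphism Z -> L k})
         (g : forall k, {rmorphism F -> L k})
         (n : 'I_r -> nat)
         (phi : forall k, {rmorphism T -> 'M[L k]_(n k)}),
  [/\ is_total_fraction_ring f /\ is_tensor_product (center_incl A) f tens,
      injective P /\ range P = @minimal_prime Z,
      forall k, is_localization (~` P k) (l k) /\ g k \o f =1 l k,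
      bijective (fun (t : T) (k : 'I_r) => phi k t) /\
        (forall k s, phi k (tens 1 s) = (g k s)%:M)
    & (forall k, (0 < n k)%N) /\ m = (\sum_k n k)%N].

(** * The center of the algebra of differential operators of a weight *)

Definition weight_center (R : realType) (N : nat) (W : R -> 'M[R[i]]_N) :
    set 'M[diffop R[i]]_N :=
  range (fun z : center (bispectral_alg W) => val (val z)).

(* Main.v *)
From HB Require Import structures.
From mathcomp Require Import all_boot all_order all_algebra.
From mathcomp Require Import complex ring zify.
From mathcomp Require Import all_classical all_reals all_analysis.
Require Import Defs.

(** Write A for the algebra D(W), Z for its center and F for the total ring of
    fractions of Z.  The diagonal matrix units of the factors M_{n_i}(F_i) are
    n_1 + ... + n_r nonzero orthogonal idempotents of the tensor product of A
    and F over Z, and the theorem bounds their number by N.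

    Clearing denominators.  The tensor product is the localization S^-1 A, with
    S the set of nonzerodivisors of Z ([tens_fraction_ex], [tens_eq0]).  Hence
    each idempotent becomes an element of A after multiplication by an element
    of S, and the relations between them, which hold in A only up to S-torsion,
    hold exactly after one more such multiplication.  The result is a family
    b_i of n_1 + ... + n_r elements of A with b_i b_j = 0 for distinct i, j and
    b_i^2 nonzero ([lift_orthogonal_idempotents],
    [module_rank_orthogonal_family]).

    Counting in matrices of differential operators.  The algebra A lies in the
    N x N matrices over the ring of differential operators with polynomial
    coefficients, and there any such family has at most N members
    ([leq_card_orthogonal]).  Choose a row w_i of b_i such that w_i b_i is
    nonzero.  If a left combination of the w_i vanishes, multiplying it by b_j
    kills every term but the j-th, and the j-th coefficient is zero because
    the ring has no zero divisors ([diffop_mul_eq0]).  So the w_i are left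
    independent rows of length N.  Rows of length N contain at most N left
    independent ones, because the ring grows polynomially
    ([leq_card_left_free]): operators of order < n with coefficients of degree
    < n form a space of dimension n^2, and multiplication by the w_i raises n
    by a constant q only, so m independent rows give
    m n^2 <= N (n + q)^2 for every n. *)

Set Implicit Arguments.
Unset Strict Implicit.
Unset Printing Implicit Defensive.

Import GRing.Theory.

Local Open Scope classical_set_scope.
Local Open Scope quotient_scope.
Local Open Scope ring_scope.

(** * Modules of fractions *)

Section FractionModule.
Variables (Z : comPzRingType) (M : lmodType Z).

Record denominator : Type :=
  Denominator { den : Z; _ : `[< nonzerodivisors den >] }.

HB.instance Definition _ := [isSub for den].
HB.instance Definition _ := [Choice of denominator by <:].

Lemma denominatorP (s : denominator) : nonzerodivisors (den s).
Proof. by case: s => s /= /asboolP. Qed.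

Definition to_denominator (s : Z) (hs : nonzerodivisors s) : denominator :=
  Denominator (asboolT hs).

Fact nonzerodivisors1 : nonzerodivisors (1 : Z).
Proof. by move=> a; rewrite mul1r. Qed.

Lemma nonzerodivisorsM (s t : Z) :
  nonzerodivisors s -> nonzerodivisors t -> nonzerodivisors (s * t).
Proof. by move=> hs ht a; rewrite -mulrA => /hs /ht. Qed.

Definition denominator1 := to_denominator nonzerodivisors1.
Definition denominatorM (s t : denominator) :=
  to_denominator (@nonzerodivisorsM _ _ (@denominatorP s) (@denominatorP t)).

(** The factor [den u] makes the relation transitive when M has torsion under
    the nonzerodivisors of Z. *)
Definition fraction_eq (p q : M * denominator) : bool :=
  `[< exists u : denominator,
        (den u * den q.2) *: p.1 = (den u * den p.2) *: q.1 >].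

Fact fraction_eq_refl : reflexive fraction_eq.
Proof. by move=> p; apply/asboolP; exists denominator1. Qed.

Fact fraction_eq_sym : symmetric fraction_eq.
Proof.
by move=> p q; apply/asboolP/asboolP => -[u pq]; exists u.
Qed.

Fact fraction_eq_trans : transitive fraction_eq.
Proof.
move=> [y t] [x s] [z r] /asboolP[u /= uxy] /asboolP[v /= vyz].
apply/asboolP; exists (denominatorM (denominatorM u v) t) => /=.
have -> : den u * den v * den t * den r = den v * den r * (den u * den t) by ring.
have -> : den u * den v * den t * den s = den u * den s * (den v * den t) by ring.
rewrite -scalerA uxy -[in RHS]scalerA -vyz !scalerA; congr (_ *: _); ring.
Qed.

Canonical fraction_equiv :=
  EquivRel fraction_eq fraction_eq_refl fraction_eq_sym fraction_eq_trans.

Definition fraction_module : Type := {eq_quot fraction_equiv}.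

HB.instance Definition _ : EqQuotient _ fraction_equiv fraction_module :=
  EqQuotient.on fraction_module.
HB.instance Definition _ := Choice.on fraction_module.

Definition fraction (x : M) (s : denominator) : fraction_module :=
  \pi_fraction_module (x, s).

Lemma fractionP x s y t :
  fraction x s = fraction y t <->
  exists u : denominator, (den u * den t) *: x = (den u * den s) *: y.
Proof.
split=> [/eqmodP /asboolP//|h]; apply/eqmodP; exact/asboolP.
Qed.

Lemma fraction_ind (P : fraction_module -> Prop) :
  (forall x s, P (fraction x s)) -> forall v, P v.
Proof. by move=> h; elim/quotW => -[x s]; apply: h. Qed.

Definition numer (v : fraction_module) : M := (repr v).1.
Definition denom (v : fraction_module) : denominator := (repr v).2.

Lemma fraction_numer_denom v : fraction (numer v) (denom v) = v.
Proof. by rewrite /fraction /numer /denom -surjective_pairing reprK. Qed.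

Lemma numer_fraction x s : exists u : denominator,
  (den u * den s) *: numer (fraction x s)
    = (den u * den (denom (fraction x s))) *: x.
Proof. by apply/fractionP; rewrite fraction_numer_denom. Qed.

Definition fraction_add v w := fraction
  (den (denom w) *: numer v + den (denom v) *: numer w)
  (denominatorM (denom v) (denom w)).

Lemma fraction_addE x s y t :
  fraction_add (fraction x s) (fraction y t)
    = fraction (den t *: x + den s *: y) (denominatorM s t).
Proof.
have [u hu] := numer_fraction x s; have [v hv] := numer_fraction y t.
rewrite /fraction_add; apply/fractionP; exists (denominatorM u v) => /=.
move: (numer _) (denom _) hu (numer _) (denom _) hv => x' s' hu y' t' hv.
rewrite !scalerDr !scalerA; congr (_ + _).
- have -> : den u * den v * (den s * den t) * den t'
    = den v * den t * den t' * (den u * den s) by ring.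
  rewrite -scalerA hu scalerA; congr (_ *: _); ring.
- have -> : den u * den v * (den s * den t) * den s'
    = den u * den s * den s' * (den v * den t) by ring.
  rewrite -scalerA hv scalerA; congr (_ *: _); ring.
Qed.

Definition fraction_opp v := fraction (- numer v) (denom v).

Lemma fraction_oppE x s : fraction_opp (fraction x s) = fraction (- x) s.
Proof.
have [u hu] := numer_fraction x s.
by apply/fractionP; exists u; rewrite !scalerN hu.
Qed.

Fact fraction_addA : associative fraction_add.
Proof.
elim/fraction_ind => x s; elim/fraction_ind => y t; elim/fraction_ind => z r.
rewrite !fraction_addE; apply/fractionP; exists denominator1 => /=.
rewrite !scalerDr !scalerA addrA.
by congr (_ *: _ + _ *: _ + _ *: _); ring.
Qed.

Fact fraction_addC : commutative fraction_add.
Proof.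
elim/fraction_ind => x s; elim/fraction_ind => y t.
rewrite !fraction_addE; apply/fractionP; exists denominator1 => /=.
by rewrite [den s * _]mulrC [in RHS]addrC.
Qed.

Fact fraction_add0 : left_id (fraction 0 denominator1) fraction_add.
Proof.
elim/fraction_ind => x s; rewrite fraction_addE; apply/fractionP.
by exists denominator1; rewrite /= scaler0 add0r scale1r !mul1r.
Qed.

Fact fraction_addN :
  left_inverse (fraction 0 denominator1) fraction_opp fraction_add.
Proof.
elim/fraction_ind => x s; rewrite fraction_oppE fraction_addE; apply/fractionP.
by exists denominator1; rewrite /= scalerN addNr !scaler0.
Qed.

HB.instance Definition _ := GRing.isZmodule.Build fraction_module
  fraction_addA fraction_addC fraction_add0 fraction_addN.

Lemma fractionD x s y t :
  fraction x s + fraction y t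
    = fraction (den t *: x + den s *: y) (denominatorM s t).
Proof. exact: fraction_addE. Qed.

Lemma fraction_eq0 x s :
  fraction x s = 0 <-> exists u : denominator, den u *: x = 0.
Proof.
have -> : (0 = fraction 0 denominator1) by [].
split=> [/fractionP[u]|[u ux]].
  by rewrite /= mulr1 scaler0; exists u.
by apply/fractionP; exists u; rewrite /= mulr1 scaler0.
Qed.

Lemma fractionDl x y s : fraction (x + y) s = fraction x s + fraction y s.
Proof.
rewrite fractionD; apply/fractionP; exists denominator1 => /=.
by rewrite -scalerDr !scalerA; congr (_ *: _); ring.
Qed.

End FractionModule.
Arguments denominator1 {Z}.

(** * The tensor product with the total ring of fractions of the center *)

Section CenterModule.
Variable A : pzRingType.

(** A separate name for A, so that the scaling by the center does not compete
    with other module structures that A may carry. *)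
Definition center_module : Type := A.

HB.instance Definition _ := GRing.Zmodule.copy center_module A.

Definition center_scale (z : center A) (x : center_module) : center_module :=
  (val z : A) * (x : A).

Fact center_scaleA z w x :
  center_scale z (center_scale w x) = center_scale (z * w) x.
Proof. by rewrite /center_scale rmorphM mulrA. Qed.

Fact center_scale1 : left_id 1 center_scale.
Proof. by move=> x; rewrite /center_scale rmorph1 mul1r. Qed.

Fact center_scaleDr : right_distributive center_scale +%R.
Proof. by move=> z x y; exact: mulrDr. Qed.

Fact center_scaleDl x :
  {morph center_scale^~ x : z w / z + w}.
Proof. by move=> z w; rewrite /center_scale rmorphD mulrDl. Qed.

HB.instance Definition _ := GRing.Zmodule_isLmodule.Build
  (center A) center_module center_scaleA center_scale1 center_scaleDr
  center_scaleDl.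

Lemma center_scaleE (z : center A) (x : A) :
  z *: (x : center_module) = (val z : A) * x.
Proof. by []. Qed.

Lemma centerP (z : center A) (x : A) : (val z : A) * x = x * val z.
Proof. exact: (asboolW (valP z)). Qed.

End CenterModule.

Section TensorFractions.
Variables (A : pzRingType) (F : comPzRingType) (f : {rmorphism center A -> F}).
Variables (T : pzRingType) (tens : A -> F -> T).
Hypothesis fP : is_total_fraction_ring f.
Hypothesis tensP : is_tensor_product (center_incl A) f tens.

Local Notation M := (center_module A).
Local Notation denominator := (denominator (center A)).

Lemma fraction_ring_inj : injective f.
Proof.
move=> a b fab; case: fP => _ _ /(_ a b fab)[s hs sab].
by apply/eqP; rewrite -subr_eq0; apply/eqP/hs; rewrite mulrBr sab subrr.
Qed.

Lemma denominator_inv_ex (s : denominator) : exists y, f (den s) * y = 1.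
Proof. by case: fP => h _ _; apply: h; apply: denominatorP. Qed.

Definition denominator_inv (s : denominator) : F :=
  projT1 (cid (denominator_inv_ex s)).

Lemma denominator_invP s : f (den s) * denominator_inv s = 1.
Proof. exact: projT2 (cid (denominator_inv_ex s)). Qed.

Lemma common_denominator y : exists p : center A * denominator,
  y * f (den p.2) = f p.1.
Proof.
case: fP => _ /(_ y)[a [s [hs ys]]] _.
by exists (a, to_denominator hs).
Qed.

(** The bilinear map (x, a / s) |-> a x / s; the map it induces on the tensor
    product is inverse to [tens_fraction] below. *)
Definition scale_fraction (x : A) (y : F) : fraction_module M :=
  let: (a, s) := projT1 (cid (common_denominator y)) in
  fraction (a *: (x : M)) s.

Lemma scale_fractionE x y a s :
  y * f (den s) = f a -> scale_fraction x y = fraction (a *: (x : M)) s.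
Proof.
move=> ya; rewrite /scale_fraction.
case: (cid _) => -[b t] /= yb; apply/fractionP; exists denominator1 => /=.
rewrite !mul1r !scalerA; congr (_ *: _); apply: fraction_ring_inj.
rewrite !rmorphM -ya -yb; ring.
Qed.

Lemma scale_fraction_balanced : balanced (center_incl A) f scale_fraction.
Proof.
split=> [x y u|x u v|x z u].
- have [[a s] /= ua] := common_denominator u.
  rewrite !(scale_fractionE _ ua) -fractionDl; congr fraction.
  exact: scalerDr.
- have [[a s] /= ua] := common_denominator u.
  have [[b t] /= vb] := common_denominator v.
  rewrite (scale_fractionE _ ua) (scale_fractionE _ vb) fractionD.
  rewrite !scalerA -scalerDl; apply: scale_fractionE => /=.
  by rewrite rmorphD !rmorphM -ua -vb; ring.
- have [[a s] /= ua] := common_denominator u.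
  have zua : f z * u * f (den s) = f (a * z).
    by rewrite rmorphM -ua; ring.
  rewrite (scale_fractionE _ ua) (scale_fractionE _ zua); congr fraction.
  by rewrite -scalerA; congr (_ *: _); apply/esym/centerP.
Qed.

Lemma tensZ (z : center A) (x : A) y : tens (val z * x) y = tens x (f z * y).
Proof. by rewrite centerP -[RHS](balanced_mid (tensor_balanced tensP)). Qed.

Definition tens_fraction (v : fraction_module M) : T :=
  tens (numer v) (denominator_inv (denom v)).

Lemma tens_fractionE x s :
  tens_fraction (fraction x s) = tens x (denominator_inv s).
Proof.
have [u] := numer_fraction x s; rewrite /tens_fraction.
move: (numer _) (denom _) => x' s'; rewrite !center_scaleE => hu.
pose c := denominator_inv u * denominator_inv s * denominator_inv s'.
have hs : denominator_inv s = f (den u * den s') * c.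
  rewrite rmorphM /c.
  transitivity ((f (den u) * denominator_inv u)
    * (f (den s') * denominator_inv s') * denominator_inv s); last by ring.
  by rewrite !denominator_invP !mul1r.
have hs' : denominator_inv s' = f (den u * den s) * c.
  rewrite rmorphM /c.
  transitivity ((f (den u) * denominator_inv u)
    * (f (den s) * denominator_inv s) * denominator_inv s'); last by ring.
  by rewrite !denominator_invP !mul1r.
by rewrite hs hs' -!tensZ hu.
Qed.

Lemma tens_fraction_is_additive : zmod_morphism tens_fraction.
Proof.
have addP := balancedDl (tensor_balanced tensP).
suff D : {morph tens_fraction : v w / v + w}.
  by move=> v w; apply: (addIr (tens_fraction w)); rewrite subrK -D subrK.
elim/fraction_ind => x s; elim/fraction_ind => y t.
rewrite fractionD !tens_fractionE addP !center_scaleE !tensZ.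
have inv_st : denominator_inv (denominatorM s t)
    = denominator_inv s * denominator_inv t.
  transitivity ((f (den s) * denominator_inv s)
    * (f (den t) * denominator_inv t) * denominator_inv (denominatorM s t)).
    by rewrite !denominator_invP !mul1r.
  transitivity (f (den s * den t) * denominator_inv (denominatorM s t)
    * (denominator_inv s * denominator_inv t)).
    by rewrite rmorphM; ring.
  by rewrite (denominator_invP (denominatorM s t)) mul1r.
rewrite inv_st; congr (tens _ _ + tens _ _).
- by rewrite mulrCA denominator_invP mulr1.
- by rewrite mulrA denominator_invP mul1r.
Qed.

HB.instance Definition _ := GRing.isZmodMorphism.Build _ _ tens_fraction
  tens_fraction_is_additive.

(** The induced map from the tensor product to S^-1 A sends [tens x 1] to x / 1,
    which vanishes only if x is S-torsion. *)
Lemma tens_eq0 (x : A) : tens x 1 = 0 ->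
  exists2 u : center A, nonzerodivisors u & val u * x = 0.
Proof.
have [h hE _] := tensor_universal tensP scale_fraction_balanced.
move=> /(congr1 h); rewrite hE raddf0.
rewrite (@scale_fractionE _ _ 1 denominator1); last by rewrite mul1r.
rewrite scale1r => /fraction_eq0[u ux].
by exists (den u) => //; apply: denominatorP.
Qed.

(** Composing the induced map T -> S^-1 A with [tens_fraction] fixes every pure
    tensor, so by the uniqueness clause of the universal property it is the
    identity of T, and every t is the image of a fraction x / s. *)
Lemma tens_fraction_ex t : exists (x : A) (s : center A),
  nonzerodivisors s /\ t * tens 1 (f s) = tens x 1.
Proof.
have [h hE _] := tensor_universal tensP scale_fraction_balanced.
have [h0 _ h0u] := tensor_universal tensP (tensor_balanced tensP).
pose k : {additive T -> T} := tens_fraction \o h.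
have kE : k =1 h0.
  apply: h0u => x y; rewrite /= hE.
  have [[a s] /= ya] := common_denominator y.
  rewrite (scale_fractionE _ ya) tens_fractionE center_scaleE tensZ -ya.
  by rewrite -mulrA denominator_invP mulr1.
have <- : k t = t by rewrite kE -(h0u (idfun : {additive T -> T})).
exists (numer (h t)), (den (denom (h t))); split; first exact: denominatorP.
rewrite /= /tens_fraction (tensorM tensP) mulr1.
by rewrite mulrC denominator_invP.
Qed.

Lemma tens_central t y : t * tens 1 y = tens 1 y * t.
Proof.
have [x [s [hs tx]]] := tens_fraction_ex t.
have [v sv] : exists v, f s * v = 1 by case: fP => + _ _; apply.
have -> : t = tens x v.
  have -> : tens x v = tens x 1 * tens 1 v by rewrite (tensorM tensP) mulr1 mul1r.
  by rewrite -tx -mulrA (tensorM tensP) mulr1 sv (tensor1 tensP) mulr1.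
by rewrite !(tensorM tensP) mulr1 mul1r mulrC.
Qed.

(** Clearing denominators turns e i into a i with [tens (a i * a j) 1 = 0] for
    distinct i, j.  Then u (a i * a j) = 0 for some nonzerodivisor u depending
    on (i, j); scaling all the a i by the product w of these u makes the products
    vanish in A itself. *)
Lemma lift_orthogonal_idempotents (I : finType) (e : I -> T) :
  (forall i, e i * e i = e i) -> (forall i, e i <> 0) ->
  (forall i j, i != j -> e i * e j = 0) ->
  exists b : I -> A, (forall i j, i != j -> b i * b j = 0)
    /\ forall i, b i * b i <> 0.
Proof.
move=> ee e0 eo.
have /choice[a ha] : forall i, exists x, exists s,
    nonzerodivisors s /\ e i * tens 1 (f s) = tens x 1.
  by move=> i; have [x [s h]] := tens_fraction_ex (e i); exists x, s.
have /choice[s has] := ha.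
have aaE i j : tens (a i * a j) 1 = e i * e j * tens 1 (f (s i * s j)).
  rewrite -[1 in LHS]mulr1 -(tensorM tensP) -(has i).2 -(has j).2.
  rewrite -!mulrA [tens 1 (f (s i)) * _]mulrA -tens_central -!mulrA.
  by rewrite (tensorM tensP) mulr1 rmorphM [f (s i) * _]mulrC.
have /choice[u hu] : forall p : I * I, exists u : center A,
    nonzerodivisors u /\ (p.1 != p.2 -> val u * (a p.1 * a p.2) = 0).
  move=> [i j] /=; have [->|ij] := eqVneq i j.
    by exists 1; split => //; apply: nonzerodivisors1.
  have [|v hv va] := @tens_eq0 (a i * a j); first by rewrite aaE eo // mul0r.
  by exists v.
pose w := \prod_p u p.
have hw : nonzerodivisors w.
  rewrite /w; apply: (big_ind (@nonzerodivisors (center A))).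
  - exact: nonzerodivisors1.
  - exact: nonzerodivisorsM.
  - by move=> p _; case: (hu p).
have wwE i j : (val w * a i) * (val w * a j) = val (w * w) * (a i * a j).
  by rewrite rmorphM -!mulrA; congr (_ * _); rewrite !mulrA centerP.
exists (fun i => val w * a i); split=> [i j ij|i].
  have wu : w = (\prod_(p | p != (i, j)) u p) * u (i, j).
    by rewrite /w (bigD1 (i, j)) //=; ring.
  have u0 : val (u (i, j)) * (a i * a j) = 0 := (hu (i, j)).2 ij.
  by rewrite wwE [X in w * X]wu [w * _]mulrA rmorphM -mulrA u0 mulr0.
rewrite wwE => /(congr1 (tens^~ 1)); rewrite tensZ mulr1.
have tens0 : tens 0 1 = 0.
  apply: (addrI (tens 0 1)).
  by rewrite -(balancedDl (tensor_balanced tensP)) !addr0.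
rewrite tens0 => h.
have [v wv] : exists v, f (w * w * (s i * s i)) * v = 1.
  case: fP => + _ _; apply; have hsi := (has i).1.
  by do !apply: nonzerodivisorsM.
apply: (e0 i).
(* e i = (e i)^2 is tens ((w a_i)^2) 1 = 0 times a unit. *)
rewrite -[e i]mulr1 -(tensor1 tensP) -wv rmorphM -mulrA.
have -> : tens 1 (f (w * w) * (f (s i * s i) * v))
  = tens 1 (f (s i * s i)) * tens 1 (f (w * w)) * tens 1 v.
  by rewrite !(tensorM tensP) !mulr1; congr tens; ring.
rewrite !mulrA -{1}ee -aaE (tensorM tensP) mulr1 mul1r h mul0r //.
Qed.

End TensorFractions.

(** * Orthogonal elements from the module rank *)

Lemma localization_at_prime_1_neq0 (Z : comPzRingType) (P : set Z)
    (L : comPzRingType) (l : {rmorphism Z -> L}) :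
  prime_ideal P -> is_localization (~` P) l -> (1 : L) <> 0.
Proof.
move=> hP [_ _ hl] L0; have : l 1 = l 0 by rewrite rmorph1 rmorph0.
by move=> /hl[s sP]; rewrite mulr1 mulr0 => s0; apply: sP; rewrite s0; case: hP.
Qed.

(** The index set consists of the pairs (k, p) with p a diagonal position of the
    k-th matrix factor; the family lifts the corresponding matrix units. *)
Lemma module_rank_orthogonal_family (A : pzRingType) (m : nat) :
  is_module_rank A m ->
  exists (I : finType) (b : I -> A), [/\ #|I| = m,
    forall i j, i != j -> b i * b j = 0 & forall i, b i * b i <> 0].
Proof.
move=> [F] [f] [T] [tens] [r] [P] [L] [l] [g] [n] [phi].
move=> [[fP tensP] [_ rP] hl [[psi phiK psiK] _] [_ mE]].
have P_prime k : prime_ideal (P k).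
  by have : minimal_prime (P k); [rewrite -rP; exists k | case].
pose I : finType := {k : 'I_r & 'I_(n k)}.
pose d (i : I) k : 'M[L k]_(n k) := \matrix_(p, q)
  ((k == tag i) && (p == tagged i :> nat) && (p == q))%:R.
have dM i j k : d i k * d j k = if i == j then d i k else 0.
  apply/matrixP => p q; rewrite !mxE (bigD1 p) //= big1 ?addr0 => [|p' p'p].
    rewrite !mxE eqxx andbT -natrM mulnb.
    case: (eqVneq i j) => [->|ij]; rewrite !mxE.
      by rewrite andbA andbb.
    have [kpi|_] := boolP ((k == tag i) && _); last by [].
    have [kpj|_] := boolP ((k == tag j) && _); last by [].
    case/negP: ij; move: kpi kpj => /andP[/eqP ki /eqP pi] /andP[/eqP kj /eqP pj].
    clear -ki pi kj pj; case: i j ki pi kj pj => i p1 [j p2] /= ? + ?; subst.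
    by move=> -> h; apply/eqP; congr existT; apply: val_inj.
  by rewrite !mxE [p == p']eq_sym (negPf p'p) andbF mul0r.
pose e i := psi (d i).
have phie i k : phi k (e i) = d i k.
  exact: (congr1 (fun h => h k) (psiK (d i))).
have phi_inj t u : (forall k, phi k t = phi k u) -> t = u.
  by move=> tu; apply: (can_inj phiK); apply: functional_extensionality_dep.
have ee i : e i * e i = e i.
  by apply: phi_inj => k; rewrite rmorphM phie dM eqxx.
have eo i j : i != j -> e i * e j = 0.
  move=> ij; apply: phi_inj => k.
  by rewrite rmorphM !phie dM (negPf ij) rmorph0.
have e0 i : e i <> 0.
  move=> /(congr1 (phi (tag i))); rewrite rmorph0 phie => /matrixP.
  move=> /(_ (tagged i) (tagged i)); rewrite !mxE !eqxx /=.
  exact: localization_at_prime_1_neq0 (P_prime (tag i)) (hl (tag i)).1.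
have [b [bo b0]] := lift_orthogonal_idempotents fP tensP ee e0 eo.
exists I, b; split=> //.
rewrite mE card_tagged sumnE big_map big_enum /=.
by apply: eq_bigr => k _; rewrite card_ord.
Qed.

(** * Order and coefficient degree of differential operators *)

Section DiffOpSize.
Variable K : numFieldType.
Local Notation coefs D := (D : {poly {poly K}}).
Implicit Types (D E : diffop K).

Lemma size_iter_mul_dx k D :
  (size (coefs (iter k (@diffop_mul_dx K) D)) <= size (coefs D) + k)%N.
Proof.
elim: k => [|k IH] /=; first by rewrite addn0.
rewrite /diffop_mul_dx (leq_trans (size_polyD _ _)) // geq_max.
rewrite (leq_trans (size_polyMleq _ _)) ?size_polyX ?addn2 /= ?addnS //.
by rewrite (leq_trans (size_poly _ _)) // leqW.
Qed.

Lemma coef_iter_mul_dx k D j : size (coefs D) = j.+1 ->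
  (coefs (iter k (@diffop_mul_dx K) D))`_(j + k) = lead_coef (coefs D).
Proof.
move=> sD; elim: k => [|k IH] /=; first by rewrite addn0 lead_coefE sD.
rewrite /diffop_mul_dx coefD coefMX addnS /= IH coef_map_id0 ?linear0 //.
rewrite nth_default ?linear0 ?addr0 //.
by rewrite (leq_trans (size_iter_mul_dx _ _)) // sD.
Qed.

Lemma size_diffop_mul D E :
  (size (coefs (D * E)%R) <= size (coefs D) + size (coefs E))%N.
Proof.
apply: (leq_trans (size_sum _ _ _)); apply/bigmax_leqP => i _.
apply: (leq_trans (size_polyMleq _ _)).
rewrite -subn1 leq_subLR.
apply: (leq_trans (leq_add (@size_iter_mul_dx i D) (size_polyC_leq1 _))).
by rewrite addn1 add1n ltnS leq_add2l ltnW.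
Qed.

(** Moving a derivation across polynomial coefficients only produces terms of
    lower order, so leading coefficients multiply. *)
Lemma diffop_mul_eq0 D E : D * E = 0 -> D = 0 \/ E = 0.
Proof.
move=> DE0; have [->|D0] := eqVneq D 0; first by left.
have [->|E0] := eqVneq E 0; first by right.
have sD : (0 < size (coefs D))%N by rewrite size_poly_gt0.
have sE : (0 < size (coefs E))%N by rewrite size_poly_gt0.
have lt1 : ((size (coefs E)).-1 < size (coefs E))%N by rewrite prednK.
pose top := ((size (coefs D)).-1 + (size (coefs E)).-1)%N.
have := congr1 (fun G => (coefs G)`_top) DE0.
rewrite coef0 coef_sum (bigD1 (Ordinal lt1)) //= /top big1 ?addr0 => [|i ij].
  rewrite coefMC coef_iter_mul_dx ?prednK // => /eqP.
  rewrite mulf_eq0 lead_coef_eq0 (negPf D0).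
  by rewrite -lead_coefE lead_coef_eq0 (negPf E0).
rewrite coefMC nth_default ?mul0r //.
apply: (leq_trans (size_iter_mul_dx _ _)).
rewrite -{1}(prednK sD) addSnnS leq_add2l.
rewrite ltn_neqAle -ltnS prednK // ltn_ord andbT.
by apply: contra ij => /eqP ij; apply/eqP/val_inj.
Qed.

Definition coef_size_le n D := forall j, (size (nth 0%R (coefs D) j) <= n)%N.

Lemma coef_size_leD n D E :
  coef_size_le n D -> coef_size_le n E -> coef_size_le n (D + E).
Proof.
move=> hD hE j; rewrite coefD (leq_trans (size_polyD _ _)) // geq_max.
by rewrite hD hE.
Qed.

Lemma coef_size_le_sum n (I : finType) (G : I -> diffop K) :
  (forall i, coef_size_le n (G i)) -> coef_size_le n (\sum_i G i).
Proof.
move=> h; apply: (big_ind (coef_size_le n)) => //.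
- by move=> j; rewrite coef0 size_poly0.
- exact: coef_size_leD.
Qed.

Lemma coef_size_le_mul n p D E :
  coef_size_le n D -> coef_size_le p E -> coef_size_le (n + p) (D * E).
Proof.
move=> hD hE; apply: coef_size_le_sum => i j.
rewrite coefMC (leq_trans (size_polyMleq _ _)) //.
suff h : coef_size_le n (iter i (@diffop_mul_dx K) D).
  by rewrite -subn1 leq_subLR (leq_trans (leq_add (h j) (hE i))) // leq_addl.
elim: (val i) => //= k IH; apply: coef_size_leD => l.
  by rewrite coefMX; case: l => [|l] /=; rewrite ?size_poly0.
rewrite coef_map_id0 ?linear0 //; apply: leq_trans (IH l).
by rewrite (leq_trans (size_poly _ _)) // leq_pred.
Qed.

Lemma coef_size_le_ex D : exists n, coef_size_le n D.
Proof.
exists (\max_(j < size (coefs D)) size (nth 0%R (coefs D) j))%N => j.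
have [jD|jD] := ltnP j (size (coefs D)); last by rewrite nth_default ?size_poly0.
exact: (leq_bigmax (Ordinal jD)).
Qed.

End DiffOpSize.

(** * Counting independent rows by growth *)

Lemma injective_linear_dim (K : fieldType) (U V : vectType K) (phi : U -> V) :
  linear phi -> (forall u, phi u = 0 -> u = 0) -> (dim U <= dim V)%N.
Proof.
move=> phiL phi0.
pose h : {linear U -> V} := HB.pack phi (GRing.isLinear.Build _ _ _ _ phi phiL).
have /eqP k0 : lker (linfun h) == 0%VS.
  apply/lker0P => u v; rewrite !lfunE /= => uv.
  apply/eqP; rewrite -subr_eq0; apply/eqP/phi0.
  by rewrite -[phi]/(h : _ -> _) raddfB /= uv subrr.
rewrite -(dimvf U) -(dimvf V) -(limg_ker_dim (linfun h) fullv).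
by rewrite k0 capv0 dimv0 add0n dimvS ?subvf.
Qed.

(** Here N (n + q)^2 - N n^2 = 2 N q n + N q^2 <= 3 N q n < n^2. *)
Lemma square_growth_lt N m q (n := (3 * (N * q)).+1) : (N < m)%N ->
  (N * ((n + q) * (n + q)) < m * (n * n))%N.
Proof.
move=> Nm; have {Nm} : (N.+1 * (n * n) <= m * (n * n))%N.
  by rewrite leq_mul2r Nm orbT.
apply: leq_trans.
have -> : (N * ((n + q) * (n + q))
    = N * (n * n) + (2 * (N * q) * n + N * q * q))%N.
  by ring.
rewrite [(N.+1 * _)%N]mulSnr ltn_add2l.
have : (N * q * q <= N * q * (N * q))%N.
  by rewrite leq_mul2l; case: (N) => [|k]; rewrite ?mul0n // leq_pmull ?orbT.
by rewrite /n; move: (N * q)%N => a; nia.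
Qed.

Section BoxFiltration.
Variable K : numFieldType.
Local Notation coefs D := (D : {poly {poly K}}).
Implicit Types (D E : diffop K).

Definition diffop_scale (c : K) D : diffop K := c%:P *: coefs D.

Lemma diffop_mul_dx_scale c D :
  diffop_mul_dx (diffop_scale c D) = diffop_scale c (diffop_mul_dx D).
Proof.
apply/polyP => i; rewrite coefZ !coefD !coefMX !coef_map_id0 ?linear0 //.
rewrite !coefZ derivM derivC mul0r add0r mulrDr.
by case: i => [|i] //=; rewrite mulr0.
Qed.

Lemma diffop_scaleMl c D E : diffop_scale c D * E = diffop_scale c (D * E).
Proof.
rewrite /diffop_scale [RHS]scaler_sumr; apply: eq_bigr => j _.
suff -> : iter j (@diffop_mul_dx K) (diffop_scale c D)
    = diffop_scale c (iter j (@diffop_mul_dx K) D) by apply/esym/scalerAl.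
by elim: (val j) => //= k ->; rewrite diffop_mul_dx_scale.
Qed.

(** The operators of order < n with coefficients of degree < n, the box of size n,
    are coordinatized by n x n matrices over K. *)
Definition box_diffop n (M : 'M[K]_n) : diffop K :=
  \sum_(i < n) rVpoly (row i M) *: 'X^i.

Definition box_coefs n D : 'M[K]_n :=
  \matrix_(i, j) ((coefs D)`_i)`_j.

Lemma coef_box_diffop n (M : 'M[K]_n) (i : 'I_n) :
  (coefs (box_diffop M))`_i = rVpoly (row i M).
Proof.
rewrite coef_sum (bigD1 i) //= big1 => [|k ki].
  by rewrite coefZ coefXn eqxx mulr1 addr0.
by rewrite coefZ coefXn eq_sym (inj_eq val_inj) (negPf ki) mulr0.
Qed.

Lemma size_box_diffop n (M : 'M[K]_n) : (size (coefs (box_diffop M)) <= n)%N.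
Proof.
apply/leq_sizeP => j nj; rewrite coef_sum big1 // => i _.
by rewrite coefZ coefXn gtn_eqF ?mulr0 // (leq_trans (ltn_ord i)).
Qed.

Lemma coef_size_le_box n (M : 'M[K]_n) : coef_size_le n (box_diffop M).
Proof.
move=> j; have [jn|nj] := ltnP j n.
  by rewrite (coef_box_diffop M (Ordinal jn)) size_poly.
by rewrite nth_default ?size_poly0 // (leq_trans (size_box_diffop M)).
Qed.

Lemma box_diffopK n : cancel (@box_diffop n) (@box_coefs n).
Proof.
move=> M; apply/matrixP => i j.
by rewrite mxE coef_box_diffop coef_rVpoly_ord mxE.
Qed.

Lemma box_diffopP n c (M M' : 'M[K]_n) :
  box_diffop (c *: M + M') = diffop_scale c (box_diffop M) + box_diffop M'.
Proof.
rewrite /diffop_scale scaler_sumr -big_split; apply: eq_bigr => i _ /=.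
by rewrite !linearP /= scalerDl scalerA mul_polyC.
Qed.

Lemma box_coefsP n c D E :
  box_coefs n (diffop_scale c D + E) = c *: box_coefs n D + box_coefs n E.
Proof.
by apply/matrixP => i j; rewrite !mxE !coefD coefZ coefCM.
Qed.

Lemma box_coefs_eq0 n D : (size (coefs D) <= n)%N -> coef_size_le n D ->
  box_coefs n D = 0 -> D = 0.
Proof.
move=> sD cD /matrixP D0; apply/polyP => i; apply/polyP => j.
rewrite !coef0; have [ni|ni] := leqP n i.
  by rewrite [(coefs D)`_i]nth_default ?coef0 // (leq_trans sD).
have [nj|nj] := leqP n j; first by rewrite nth_default // (leq_trans (cD i)).
by have := D0 (Ordinal ni) (Ordinal nj); rewrite !mxE.
Qed.

(** The strong rank condition for the ring of differential operators.  Left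
    multiplication of the rows by coefficients in the box of size n is an
    injective K-linear map, whose image lies in the N-fold power of the box of
    size n + q; compare dimensions for large n. *)
Lemma leq_card_left_free (I : finType) (N : nat) (w : I -> 'I_N -> diffop K) :
  (forall d : I -> diffop K, (forall c, \sum_i d i * w i c = 0) ->
     forall i, d i = 0) ->
  (#|I| <= N)%N.
Proof.
move=> w_free.
have /choice[s hs] : forall p : I * 'I_N, exists n,
    coef_size_le n (w p.1 p.2) /\ (size (coefs (w p.1 p.2)) <= n)%N.
  move=> p; have [n hn] := coef_size_le_ex (w p.1 p.2).
  exists (maxn n (size (coefs (w p.1 p.2)))); rewrite leq_maxr; split=> // j.
  by rewrite (leq_trans (hn j)) ?leq_maxl.
pose q := (\max_p s p)%N.
have sq i c : (s (i, c) <= q)%N by exact: leq_bigmax.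
suff growth n : (#|I| * (n * n) <= N * ((n + q) * (n + q)))%N.
  have {growth} := growth (3 * (N * q)).+1; rewrite leqNgt => /negP hlt.
  rewrite leqNgt; apply/negP => NI; apply: hlt.
  exact: (@square_growth_lt N #|I| q).
pose phi (g : {ffun I -> 'M[K]_n}) : {ffun 'I_N -> 'M[K]_(n + q)} :=
  [ffun c => box_coefs (n + q) (\sum_i box_diffop (g i) * w i c)].
have phi_linear : linear phi.
  move=> a g g'; apply/ffunP => c; rewrite !ffunE -box_coefsP.
  congr box_coefs; rewrite /diffop_scale scaler_sumr -big_split.
  apply: eq_bigr => i _ /=; rewrite !ffunE box_diffopP mulrDl diffop_scaleMl //.
have dim_mx_ffun (J : finType) p :
    dim {ffun J -> 'M[K]_p} = (#|J| * (p * p))%N by [].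
have := injective_linear_dim phi_linear; rewrite !dim_mx_ffun card_ord.
apply=> g /ffunP g0; apply/ffunP => i.
rewrite ffunE -[LHS]box_diffopK.
suff -> : box_diffop (g i) = 0 by apply/matrixP => k l; rewrite !mxE !coef0.
apply: (w_free (fun i => box_diffop (g i))) => c; apply: (@box_coefs_eq0 (n + q)).
- apply: (leq_trans (size_sum _ _ _)); apply/bigmax_leqP => k _.
  apply: (leq_trans (size_diffop_mul _ _)); apply: leq_add.
    exact: size_box_diffop.
  exact: leq_trans (hs (k, c)).2 (sq k c).
- apply: coef_size_le_sum => k; apply: coef_size_le_mul.
    exact: coef_size_le_box.
  by move=> j; apply: leq_trans (sq k c); apply: (hs (k, c)).1.
by have := g0 c; rewrite !ffunE.
Qed.

(** Nonzero rows of the squares [b i *m b i] provide left independent rows of the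
    [b i]: right multiplication by [b j] isolates the j-th coefficient of a
    relation. *)
Lemma leq_card_orthogonal (I : finType) (N : nat) (b : I -> 'M[diffop K]_N) :
  (forall i j, i != j -> b i *m b j = 0) -> (forall i, b i *m b i <> 0) ->
  (#|I| <= N)%N.
Proof.
move=> bo b0.
have /choice[p hp] : forall i, exists p, row p (b i *m b i) != 0.
  move=> i; apply: contrapT => h; apply: (b0 i); apply/row_matrixP => p.
  by rewrite row0; apply/eqP/negPn/negP => hp; apply: h; exists p.
apply: (@leq_card_left_free I N (fun i c => b i (p i) c)) => d d0 j.
pose x : 'rV[diffop K]_N := \sum_i (d i) *: row (p i) (b i).
have x0 : x = 0.
  apply/rowP => c; rewrite summxE [RHS]mxE; apply: etrans (d0 c).
  apply: eq_bigr => i _.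
  by rewrite !mxE.
have /rowP xb : d j *: row (p j) (b j *m b j) = 0.
  rewrite -[RHS](mul0mx _ (b j)) -x0 mulmx_suml (bigD1 j) //=.
  rewrite big1 ?addr0 => [|i ij].
    by rewrite -scalemxAl -row_mul.
  by rewrite -scalemxAl -row_mul bo // row0 scaler0.
apply: contrapT => dj0; case/negP: (hp j); apply/eqP/rowP => c.
move: (xb c); rewrite [X in X = _ -> _]mxE [X in _ = X -> _]mxE.
by case/diffop_mul_eq0 => [//|->]; rewrite mxE.
Qed.
End BoxFiltration.

(** * The module rank of D(W) *)

Theorem proposition4p19 (R : realType) (N : nat) (x0 x1 : \bar R)
    (W : R -> 'M[R[i]]_N) (hW : weight_matrix x0 x1 W)
    (hZ : range (@scalar_mxdiffop R[i] N) `<` weight_center W)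
    (m : nat) (hm : is_module_rank (bispectral_alg W) m) :
  (m <= N)%N.
Proof.
have [I [b [<- bo b0]]] := module_rank_orthogonal_family hm.
apply: (@leq_card_orthogonal R[i] I N (fun i => val (b i))) => [i j ij|i].
  by have := congr1 val (bo i j ij); rewrite rmorphM rmorph0.
move=> bb; apply: (b0 i); apply: val_inj; rewrite rmorphM rmorph0; exact: bb.
Qed.
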